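(* For every graph $G$, the end space of $G$ is second countable if and only if $G$ is countably determined.
   Context: Graphs may be infinite of any cardinality and need not be connected. Countable means finite or countably infinite. A ray is a one-way infinite path. Two rays in $G$ are equivalent if no finite set of vertices separates them; the equivalence classes are the ends of $G$, and $\Omega(G)$ is the set of ends. For finite $X\subseteq V(G)$ and $\omega\in\Omega(G)$, $C(X,\omega)$ is the unique component of $G-X$ that contains a tail of every ray in $\omega$. The end space of $G$ is $\Omega(G)$ with the topology having as a basis all sets $\Omega(X,C)=\{\omega\in\Omega(G): C(X,\omega)=C\}$, with $X\subseteq V(G)$ finite and $C$ a component of $G-X$. Second countable means having a countable base. A direction of $G$ is a map $f$ that assigns to every finite set $X\subseteq V(G)$ a component $f(X)$ of $G-X$ such that $f(X)\supseteq f(X')$ whenever $X\subseteq X'$. A directional choice in $G$ is a pair $(X,C)$ of a finite set $X\subseteq V(G)$ and a component $C$ of $G-X$. It distinguishes a direction $f$ from another direction $h$ if $f(X)=C$ and $h(X)\neq C$. The graph $G$ is countably determined if there is a countable set of directional choices in $G$ that distinguish every two directions of $G$ from each other (i.e. for any two distinct directions $f,h$, some directional choice in the set distinguishes $f$ from $h$). *)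

(* Defs.v *)
From HB Require Import structures.
From Stdlib Require Import Relation_Operators.
From mathcomp Require Import all_boot.
From mathcomp Require Import all_classical topology.

Set Implicit Arguments.
Unset Strict Implicit.
Unset Printing Implicit Defensive.

Local Open Scope classical_set_scope.

Record graph := Graph {
  vertex :> Type;
  adj : vertex -> vertex -> Prop;
  adj_sym : forall x y, adj x y -> adj y x;
  adj_irrefl : forall x, ~ adj x x }.

Section Graph.
Variable G : graph.
Implicit Types (U X Y C A B : set G) (x y z u v : G).

(* [linked U x y]: [x] and [y] are joined by a walk (equivalently, a path) of
   G[U]. The conjunct [U x] only matters for the trivial walk at a vertex
   outside [U]. *)
Definition induced_adj U x y := [/\ adj x y, U x & U y].
Definition linked U x y := U x /\ clos_refl_trans G (induced_adj U) x y.

Definition connected_in U := U !=set0 /\ forall x y, U x -> U y -> linked U x y.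

(* A component of G - X is an induced subgraph, hence is represented by its
   vertex set. *)
Definition component X C :=
  [/\ connected_in C, C `<=` ~` X &
      forall D, connected_in D -> D `<=` ~` X -> C `<=` D -> D `<=` C].

Definition separates X A B :=
  forall x y, A x -> B y -> ~ linked (~` X) x y.

Record ray := Ray {
  ray_vertex :> nat -> G;
  ray_inj : injective ray_vertex;
  ray_adj : forall n, adj (ray_vertex n) (ray_vertex n.+1) }.

Definition ray_equiv (r s : ray) :=
  forall X, finite_set X -> ~ separates X (range r) (range s).

Definition ends := {w : set ray | exists r, w = [set s | ray_equiv r s]}.

Definition contains_tail C (r : ray) :=
  exists n, forall m, (n <= m)%N -> C (r m).

Definition is_end_component X (w : ends) C :=
  component X C /\ forall r, sval w r -> contains_tail C r.

(* C(X, w); the default value [set0] is never used for finite [X], see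
   [end_componentP]. *)
Definition end_component X (w : ends) : set G :=
  xget set0 [set C | is_end_component X w C].

Definition Omega X C : set ends := [set w | end_component X w = C].

Lemma clos_sub U Y x y : U `<=` Y ->
  clos_refl_trans G (induced_adj U) x y -> clos_refl_trans G (induced_adj Y) x y.
Proof.
move=> UY; elim=> [a b [ab Ua Ub]|a|a b c _ h1 _ h2].
- by apply: rt_step; split=> //; exact: UY.
- exact: rt_refl.
- exact: rt_trans h1 h2.
Qed.

Lemma clos_sym U x y :
  clos_refl_trans G (induced_adj U) x y -> clos_refl_trans G (induced_adj U) y x.
Proof.
elim=> [a b [ab Ua Ub]|a|a b c _ h1 _ h2].
- by apply: rt_step; split=> //; exact: adj_sym.
- exact: rt_refl.
- exact: rt_trans h2 h1.
Qed.

Lemma clos_in U x y : clos_refl_trans G (induced_adj U) x y -> U x -> U y.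
Proof. by elim=> [a b []|a|a b c _ h1 _ h2 /h1/h2]. Qed.

Lemma linked_sub U Y x y : U `<=` Y -> linked U x y -> linked Y x y.
Proof. by move=> UY [Ux h]; split; [exact: UY|exact: clos_sub h]. Qed.

Lemma linked_sym U x y : linked U x y -> linked U y x.
Proof. by move=> [Ux h]; split; [exact: clos_in h Ux|exact: clos_sym]. Qed.

Lemma linked_trans U x y z : linked U x y -> linked U y z -> linked U x z.
Proof. by move=> [Ux h] [_ h']; split=> //; exact: rt_trans h h'. Qed.

Lemma linked_class U x y : linked U x y -> linked (linked U x) x y.
Proof.
move=> [Ux h]; split; first by split=> //; exact: rt_refl.
have main : forall a b, clos_refl_trans G (induced_adj U) a b -> linked U x a ->
    clos_refl_trans G (induced_adj (linked U x)) a b.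
  move=> a b; elim=> [c d [cd Uc Ud] xc|c _|c d e cd h1 de h2 xc].
  - apply: rt_step; split=> //; apply: linked_trans xc _; split=> //.
    exact: rt_step.
  - exact: rt_refl.
  - have [_ xd] : linked U x d.
      by split; [case: xc|case: xc => _ xc; exact: rt_trans xc cd].
    by apply: rt_trans (h1 xc) (h2 _); split=> //; case: xc.
by apply: main => //; split=> //; exact: rt_refl.
Qed.

Lemma component_class X x : ~ X x -> component X (linked (~` X) x).
Proof.
move=> nXx; have xx : linked (~` X) x x by split=> //; exact: rt_refl.
split.
- split; first by exists x.
  move=> y z /linked_class/linked_sym yx /linked_class; exact: linked_trans.
- by move=> y [nx h]; exact: clos_in h nx.
- move=> D [_ cD] DX xD y Dy; apply: linked_sub DX _.
  by apply: cD => //; exact: xD.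
Qed.

Lemma component_linked X C x : component X C -> C x -> C = linked (~` X) x.
Proof.
move=> [[_ cC] CX maxC] Cx.
have nXx : ~ X x by exact: CX.
have sub : C `<=` linked (~` X) x.
  by move=> y Cy; apply: linked_sub CX _; exact: cC.
rewrite eqEsubset; split=> //.
by have [cD DX _] := component_class nXx; exact: maxC.
Qed.

Lemma component_uniq X C C' x :
  component X C -> component X C' -> C x -> C' x -> C = C'.
Proof.
by move=> cC cC' Cx C'x; rewrite (component_linked cC Cx) (component_linked cC' C'x).
Qed.

Lemma ray_avoids X (r : ray) : finite_set X ->
  exists n, forall m, (n <= m)%N -> ~ X (r m).
Proof.
move=> finX.
have fin : finite_set (r @^-1` X).
  by apply: finite_preimage => // a b _ _; exact: ray_inj.
have /finite_seqP[s sE] := fin.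
exists (\max_(i <- s) i).+1 => m lem Xm.
have ms : m \in s by have : (r @^-1` X) m by []; rewrite sE.
by move: lem; rewrite ltnNge (@leq_bigmax_seq _ s xpredT (fun i => i) m).
Qed.

Lemma ray_linked U (r : ray) n m : (forall k, (n <= k)%N -> U (r k)) ->
  (n <= m)%N -> linked U (r n) (r m).
Proof.
move=> rU; elim: m => [|m IH].
  by rewrite leqn0 => /eqP n0; split; [exact: rU|rewrite n0; exact: rt_refl].
rewrite leq_eqVlt => /orP[/eqP <-|]; first by split; [exact: rU|exact: rt_refl].
rewrite ltnS => nm; apply: linked_trans (IH nm) _; split; first exact: rU.
by apply: rt_step; split; [exact: ray_adj|exact: rU|apply: rU; exact: leqW].
Qed.

Lemma ray_equiv_refl r : ray_equiv r r.
Proof.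
move=> X finX sep; have [n nX] := ray_avoids r finX.
have Rn : range r (r n) by exists n.
by apply: (sep _ _ Rn Rn); apply: (@ray_linked _ _ n n) => // k; exact: nX.
Qed.

Lemma ray_equiv_tail r s X C : ray_equiv r s -> finite_set X ->
  component X C -> contains_tail C r -> contains_tail C s.
Proof.
move=> rs finX cC [n Cn]; have [k sX] := ray_avoids s finX.
pose Y := X `|` (r @` `I_n) `|` (s @` `I_k).
have finY : finite_set Y.
  by rewrite !finite_setU; split; first split => //;
     apply: finite_image; exact: finite_II.
have YX : ~` Y `<=` ~` X by apply: subsetC => z Xz; do 2 left.
have [_ CX _] := cC.
have [x [y [[i _ xi] [j _ yj] xy]]] :
    exists x y, [/\ range r x, range s y & linked (~` Y) x y].
  have := rs Y finY; apply: contra_notP => h x y rx sy xy.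
  by apply: h; exists x, y.
have Yx : ~ Y x by case: xy.
have Yy : ~ Y y by case/linked_sym: xy.
have ni : (n <= i)%N.
  by rewrite leqNgt; apply/negP => lt; apply: Yx; left; right; exists i.
have kj : (k <= j)%N.
  by rewrite leqNgt; apply/negP => lt; apply: Yy; right; exists j.
have Cx : C x by rewrite -xi; exact: Cn.
exists j => m jm; rewrite (component_linked cC Cx).
apply: linked_trans (linked_sub YX xy) _; rewrite -yj.
by apply: ray_linked jm => l jl; apply: sX; exact: leq_trans kj jl.
Qed.

Lemma end_componentP X w : finite_set X -> is_end_component X w (end_component X w).
Proof.
move=> finX; suff [C hC] : exists C, is_end_component X w C.
  by rewrite /end_component; case: xgetP => [D _ //|/(_ C)]; exact.
case: w => W [r Wr]; have [n rX] := ray_avoids r finX.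
have cC := component_class (rX n (leqnn n)).
exists (linked (~` X) (r n)); split=> // s /=; rewrite Wr => rs.
apply: ray_equiv_tail rs finX cC _; exists n => m nm.
exact: ray_linked nm.
Qed.

Lemma end_component_uniq X w C : finite_set X ->
  is_end_component X w C -> end_component X w = C.
Proof.
move=> finX [cC tC]; have [cD tD] := end_componentP w finX.
have [r Wr] : exists r, sval w r.
  by case: w {tC tD cD} => W [r /= ->]; exists r; exact: ray_equiv_refl.
have [[n nC] [m mD]] := (tC r Wr, tD r Wr).
by apply: (component_uniq (x := r (maxn n m)) cD cC);
  [apply: mD; exact: leq_maxr|apply: nC; exact: leq_maxl].
Qed.

Definition Omega_index : set (set G * set G) :=
  [set XC | finite_set XC.1 /\ component XC.1 XC.2].

Lemma Omega_cover : \bigcup_(XC in Omega_index) Omega XC.1 XC.2 = [set: ends].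
Proof.
rewrite eqEsubset; split=> // w _; exists (set0, end_component set0 w) => //.
split=> /=; first exact: finite_set0.
by case: (end_componentP w (finite_set0 _)).
Qed.

Lemma Omega_join (i j : set G * set G) w : Omega_index i -> Omega_index j ->
  Omega i.1 i.2 w -> Omega j.1 j.2 w ->
  exists k : set G * set G, [/\ Omega_index k, Omega k.1 k.2 w &
    Omega k.1 k.2 `<=` Omega i.1 i.2 `&` Omega j.1 j.2].
Proof.
move=> [finX cX] [finY cY] wX wY; pose Z := i.1 `|` j.1.
have finZ : finite_set Z by rewrite finite_setU.
exists (Z, end_component Z w); split=> //=.
  by split=> //=; case: (end_componentP w finZ).
have main : forall (X C : set G) w', finite_set X -> component X C -> X `<=` Z ->
    Omega X C w -> Omega Z (end_component Z w) w' -> Omega X C w'.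
  move=> X C w' {}finX {}cX XZ {}wX; rewrite /Omega/= => w'E.
  have ZC : end_component Z w `<=` C.
    have [cD tD] := end_componentP w finZ.
    have [cC tC] := end_componentP w finX.
    have [r Wr] : exists r, sval w r.
      by exists (projT1 (cid (svalP w))); rewrite {1}(projT2 (cid (svalP w)));
        exact: ray_equiv_refl.
    have [n nD] := tD r Wr; have [m mC] := tC r Wr.
    pose x := r (maxn n m).
    have Dx : end_component Z w x by apply: nD; exact: leq_maxl.
    have Cx : C x by rewrite -wX; apply: mC; exact: leq_maxr.
    rewrite (component_linked cD Dx) (component_linked cX Cx) => y.
    by apply: linked_sub; exact: subsetC.
  apply: end_component_uniq => //; split=> // r w'r.
  have [_ /(_ r w'r)] := end_componentP w' finZ; rewrite w'E => -[n h].
  by exists n => m nm; apply: ZC; exact: h.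
by move=> w' hw'; split; apply: main hw' => // z hz; [left|right].
Qed.

HB.instance Definition _ := gen_eqMixin ends.
HB.instance Definition _ := gen_choiceMixin ends.
HB.instance Definition _ := isBaseTopological.Build ends Omega_cover Omega_join.

Definition finsubset := {X : set G | finite_set X}.

Definition direction (f : finsubset -> set G) :=
  (forall X : finsubset, component (sval X) (f X)) /\
  (forall X X' : finsubset, sval X `<=` sval X' -> f X' `<=` f X).

Definition directional_choice (XC : finsubset * set G) :=
  component (sval XC.1) XC.2.

Definition distinguishes (XC : finsubset * set G) (f h : finsubset -> set G) :=
  f XC.1 = XC.2 /\ h XC.1 <> XC.2.

Definition countably_determined :=
  exists S : set (finsubset * set G),
    [/\ countable S, S `<=` directional_choice &
        forall f h, direction f -> direction h -> f <> h ->
          exists2 XC, S XC & distinguishes XC f h].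

End Graph.

(* Main.v *)
(** Call a vertex set [U] walk-closed if any two vertices of [U] that are linked in
    [G - X], for a finite [X] included in [U], are already linked inside [U - X].
    Every countable set has a countable walk-closed hull, which can moreover be made
    to meet [f X] for every finite subset [X] of [U], where [f] is a given direction.
    The sets [f X] with [X] in [U] then trace out a ray of [U] that follows [f] on
    the finite subsets of [U]. With [U] well chosen, this shows that every direction
    is the direction of an end, so a countable base yields countably many choices
    by picking one [Omega X C] between any two nested base sets, where possible.
    Conversely, let [S] be a countable distinguishing set of choices. Only countably
    many components of [G - X] contain an end, so one countable walk-closed [U]
    contains all vertex sets of [S] and meets [C(X, w)] for all ends [w] and finite
    subsets [X] of [U]. Every end then has a ray inside [U], as no choice of [S]
    tells the end apart from the ray that follows it. The sets
    [Omega Y C] with [Y] in [U] form a base: given [X], take [Y = X `&` U]; the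
    connected set [C(Y, w) `&` U] avoids [X] and contains a ray of every end in
    [Omega Y C(Y, w)]. *)
From Stdlib Require Import Relation_Operators.
Require Import Defs.
From mathcomp Require Import all_boot all_classical topology.

Set Implicit Arguments.
Unset Strict Implicit.
Unset Printing Implicit Defensive.

Local Open Scope classical_set_scope.

(** * Finite subsets of countable sets *)

Section CountableSets.
Variable T : Type.
Implicit Types A B Z U : set T.

Lemma countable_setU A B : countable A -> countable B -> countable (A `|` B).
Proof.
move=> cA cB; have -> : A `|` B = \bigcup_(b in [set: bool]) (if b then A else B).
  rewrite eqEsubset; split=> x.
    by case=> h; [exists true|exists false].
  by case=> -[] _ h; [left|right].
by apply: bigcup_countable => // -[].
Qed.

Lemma finite_nat_ub (A : set nat) : finite_set A ->
  exists n, forall i, A i -> (i <= n)%N.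
Proof.
move=> /finite_seqP[s ->]; exists (\max_(i <- s) i) => i /= si.
by rewrite (@leq_bigmax_seq _ s xpredT (fun i => i) i).
Qed.

Lemma nondecreasing_seq_sub (Y : nat -> set T) m n :
  (forall n, Y n `<=` Y n.+1) -> (m <= n)%N -> Y m `<=` Y n.
Proof.
move=> Yn /subnK <-; elim: (n - m)%N => [//|k IH] x /IH.
by rewrite addSn; exact: Yn.
Qed.

Lemma finite_sub_bigcup (Y : nat -> set T) Z : (forall n, Y n `<=` Y n.+1) ->
  finite_set Z -> Z `<=` \bigcup_n Y n -> exists n, Z `<=` Y n.
Proof.
move=> Yn finZ ZY.
have /choice[N NP] : forall x, exists n, Z x -> Y n x.
  by move=> x; have [/ZY[n _ ?]|?] := pselect (Z x); [exists n|exists 0].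
have [n nP] := finite_nat_ub (finite_image N finZ).
exists n => x Zx; apply: (nondecreasing_seq_sub Yn _ (NP x Zx)).
by apply: nP; exists x.
Qed.

(** Cut [U] off at the values of an injection into the naturals. Conditions on all finite subsets of
    [U] can then be handled along a sequence. *)
Lemma countable_exhaustion U : countable U -> exists Y : nat -> set T,
  [/\ forall n, finite_set (Y n), forall n, Y n `<=` U,
      forall n, Y n `<=` Y n.+1 &
      forall Z, finite_set Z -> Z `<=` U -> exists n, Z `<=` Y n].
Proof.
move=> /countable_injP[f finj].
pose Y n : set T := U `&` [set x | (f x < n)%N].
have Yn n : Y n `<=` Y n.+1 by move=> x [Ux /= fx]; split=> //=; exact: ltnW.
exists Y; split=> //.
- move=> n.
  suff h : forall n, finite_set (Y n) by exact: h.
  elim=> [|{}n IH]; first by apply: (@sub_finite_set _ _ set0) => // x [_].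
  apply: (@sub_finite_set _ _ (Y n `|` (U `&` [set x | f x = n]))).
    move=> x [Ux /=]; rewrite ltnS leq_eqVlt => /orP[/eqP fx|fx].
      by right.
    by left.
  rewrite finite_setU; split=> //.
  have [[x [Ux fx]]|nE] := pselect (exists x, (U `&` [set x | f x = n]) x).
    apply: (@sub_finite_set _ _ [set x]) => // y [Uy fy].
    by apply: finj; rewrite ?inE //= fx fy.
  by apply: (@sub_finite_set _ _ set0) => // x Ux; case: nE; exists x.
- by move=> n x [].
- move=> Z finZ ZU; apply: finite_sub_bigcup => // x /ZU Ux.
  by exists (f x).+1 => //; split=> //=.
Qed.

(** Countably many rounds of adding [F Y] are enough: a finite subset of the union of the stages
    already lies in one stage. *)
Lemma countable_closure (F : set T -> set T) A : countable A ->
  (forall Y, finite_set Y -> countable (F Y)) ->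
  exists U, [/\ countable U, A `<=` U &
                forall Y, finite_set Y -> Y `<=` U -> F Y `<=` U].
Proof.
move=> cA cF.
pose step U := U `|` \bigcup_(Y in [set Y | Y `<=` U /\ finite_set Y]) F Y.
pose V n := iter n step A.
have Vn n : V n `<=` V n.+1 by move=> x Vx; left.
exists (\bigcup_n V n); split.
- apply: bigcup_countable => // n _; elim: n => [//|n IH].
  apply: (countable_setU IH); apply: bigcup_countable => [|Y [_ /cF//]].
  exact: countable_finite_subset.
- by move=> x Ax; exists 0.
- move=> Y finY YV; have [n Yn] := finite_sub_bigcup Vn finY YV.
  by move=> x Fx; exists n.+1 => //; right; exists Y.
Qed.

End CountableSets.

(** * Walks and rays *)

Section Walks.
Variable G : graph.
Implicit Types (U X Y Z C A : set G) (x y u v : G).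

Lemma linked_refl U x : U x -> linked U x x.
Proof. by move=> Ux; split=> //; exact: rt_refl. Qed.

Lemma linked_adj U x y : adj x y -> U x -> U y -> linked U x y.
Proof. by move=> xy Ux Uy; split=> //; exact: rt_step. Qed.

Lemma linked_right U x y : linked U x y -> U y.
Proof. by case/linked_sym. Qed.

Lemma linked_finite U x y : linked U x y ->
  exists Z, [/\ finite_set Z, Z `<=` U & linked Z x y].
Proof.
move=> [Ux h]; elim: h Ux => [a b [ab Ua Ub] _|a Ua|a b c ab IHab bc IHbc Ua].
- exists ([set a] `|` [set b]); split.
  + by rewrite finite_setU; split.
  + by move=> z [] ->.
  + by apply: linked_adj => //; [left|right].
- exists [set a]; split=> //; first by move=> z ->.
  exact: linked_refl.
- have [Z [finZ ZU ab']] := IHab Ua.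
  have [Z' [finZ' Z'U bc']] := IHbc (clos_in ab Ua).
  exists (Z `|` Z'); split.
  + by rewrite finite_setU.
  + by move=> z [/ZU|/Z'U].
  + apply: (linked_trans (y := b)).
      by apply: linked_sub ab' => z; left.
    by apply: linked_sub bc' => z; right.
Qed.

Lemma linked_exit U A x y : linked U x y -> A x -> ~ A y ->
  exists a b, [/\ linked (U `&` A) x a, adj a b, U b & ~ A b].
Proof.
move=> [Ux h] Ax nAy; apply: contrapT => nE.
suff /linked_right[_ //] : linked (U `&` A) x y.
have main a b : clos_refl_trans G (induced_adj U) a b ->
    linked (U `&` A) x a -> linked (U `&` A) x b.
  elim=> [c d [cd Uc Ud]|c //|c d e _ h1 _ h2 /h1/h2//] xc.
  have [Ad|nAd] := pselect (A d); last by case: nE; exists c, d.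
  apply: (linked_trans xc); apply: linked_adj => //.
  exact: (linked_right xc).
by apply: main h _; exact: linked_refl.
Qed.

Lemma component_closed X C x y : component X C -> C x -> linked (~` X) x y -> C y.
Proof. by move=> cC Cx xy; rewrite (component_linked cC Cx). Qed.

Lemma component_avoids X C x : component X C -> C x -> ~ X x.
Proof. by case=> _ CX _ /CX. Qed.

Lemma component_connected X C x y : component X C -> C x -> C y -> linked C x y.
Proof. by case=> -[_ h] _ _; exact: h. Qed.

Lemma component_neq0 X C : component X C -> exists x, C x.
Proof. by case=> -[[x Cx] _] _ _; exists x. Qed.

(* Erasing everything between a vertex and its last visit turns a walk that
   visits every vertex only finitely often into a ray. *)
Lemma walk_ray (w : nat -> G) :
  (forall i, w i.+1 = w i \/ adj (w i) (w i.+1)) ->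
  (forall x, exists n, forall i, (n <= i)%N -> w i <> x) ->
  exists (r : ray G) (t : nat -> nat),
    (forall k, (k <= t k)%N) /\ forall k, r k = w (t k).
Proof.
move=> wS wfin.
have last_visit i : exists l, [/\ (i <= l)%N, w l = w i &
    forall k, (l < k)%N -> w k <> w i].
  have [n nP] := wfin (w i).
  pose P l := (i <= l)%N && `[< w l = w i >].
  have exP : exists l, P l by exists i; rewrite /P leqnn; exact/asboolP.
  have ubP l : P l -> (l <= n)%N.
    move=> /andP[_ /asboolP wl]; rewrite leqNgt; apply/negP => nl.
    by apply: (nP l) => //; exact: ltnW.
  case: (ex_maxnP exP ubP) => l /andP[il /asboolP wl] lmax.
  exists l; split=> // k lk wk.
  have /lmax : P k by apply/andP; split; [exact: leq_trans il (ltnW lk)|exact/asboolP].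
  by rewrite leqNgt lk.
have [L LP] := choice last_visit.
(* The position after the last visit to a vertex carries a neighbour of it, which is then followed
   to its own last visit. *)
pose t := fix t k := if k is k'.+1 then L (t k').+1 else L 0.
have tlast k i : (t k < i)%N -> w i <> w (t k).
  by case: k => [|k] /=; [have [_ -> h] := LP 0|have [_ -> h] := LP (t k).+1];
    exact: h.
have tS k : (t k < t k.+1)%N by have [] := LP (t k).+1.
have tmono k l : (k < l)%N -> (t k < t l)%N.
  elim: l => [//|l IH]; rewrite ltnS leq_eqVlt => /orP[/eqP->//|/IH h].
  exact: ltn_trans h (tS l).
have rinj : injective (w \o t).
  move=> k l /= wkl; case: (ltngtP k l) => // /tmono h.
    by case: (tlast k _ h).
  by case: (tlast l _ h).
have radj k : adj ((w \o t) k) ((w \o t) k.+1).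
  rewrite /=; have [_ -> _] := LP (t k).+1.
  by case: (wS (t k)) => // h; case: (tlast k _ (ltnSn _)).
exists (Ray rinj radj), t; split=> // k.
by elim: k => [//|k IH]; exact: leq_ltn_trans IH (tS k).
Qed.

(** Walk inside [A n] until [A n.+1] is reached, then go on with the next level. The walk ends up
    inside every [A n] and each vertex misses some [A n], so [walk_ray] applies. *)
Lemma decreasing_ray (A : nat -> set G) :
  (forall n, connected_in (A n)) -> (forall n, A n.+1 `<=` A n) ->
  (forall x, exists n, ~ A n x) ->
  exists r : ray G, forall n, contains_tail (A n) r.
Proof.
move=> cA decA capA.
have decA' m n : (m <= n)%N -> A n `<=` A m.
  by move=> /subnK <-; elim: (n - m)%N => [//|k IH] x; rewrite addSn => /decA/IH.
(* [B n m]: the vertices from which some walk of length [m] in [A n] leads to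
   [A n.+1]. *)
pose B n := fix B m := if m is m'.+1
  then [set v | A n v /\ exists2 v', B m' v' & adj v v'] else A n.+1.
have BA n m : B n m `<=` A n by case: m => [|m] v; [exact: decA|case].
have reach n v : A n v -> exists m, B n m v.
  move=> Av; have [[y Ay] _] := cA n.+1.
  have [_ /(_ v y Av (decA n y Ay))[_ h]] := cA n.
  suff : forall a b, clos_refl_trans G (induced_adj (A n)) a b ->
      (exists m, B n m b) -> exists m, B n m a.
    by move=> /(_ _ _ h); apply; exists 0.
  move=> a b; elim=> [c d [cd Ac Ad] [m Bd]|//|c d e _ h1 _ h2 /h2/h1//].
  by exists m.+1; split=> //; exists d.
(* A state [(n, m, v)] records the level, the number of steps left to [A n.+1] and the current
   vertex. When no step is left, the level rises and the vertex is repeated. *)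
pose state := {s : nat * nat * G | B s.1.1 s.1.2 s.2}.
pose lev (s : state) := (sval s).1.1; pose rem (s : state) := (sval s).1.2.
pose vx (s : state) := (sval s).2.
have step (s : state) : exists s' : state,
    (vx s' = vx s \/ adj (vx s) (vx s')) /\
    if rem s is m.+1 then lev s' = lev s /\ rem s' = m else lev s' = (lev s).+1.
  case: s => -[[n [|m]] v] /= Bv.
    have [m Bm] := reach _ _ Bv.
    by exists (exist _ (n.+1, m, v) Bm); split=> //=; left.
  have [_ [v' Bv' vv']] := Bv.
  by exists (exist _ (n, m, v') Bv'); split=> //=; right.
have [next nextP] := choice step.
have [[x0 Ax0] _] := cA 0; have [m0 Bx0] := reach _ _ Ax0.
pose s i := iter i next (exist _ (0, m0, x0) Bx0 : state).
have levS i : (lev (s i) <= lev (s i.+1))%N.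
  have [_] := nextP (s i); rewrite -/(s i.+1).
  by case: (rem (s i)) => [->|m [-> _]].
have lev_mono i j : (i <= j)%N -> (lev (s i) <= lev (s j))%N.
  by move=> /subnK <-; elim: (j - i)%N => [//|k IH];
    rewrite addSn; exact: leq_trans IH (levS _).
have lev_up m i : rem (s i) = m -> lev (s (m.+1 + i)) = (lev (s i)).+1.
  elim: m i => [|m IH] i si; have [_] := nextP (s i); rewrite si => //.
  by move=> [<- si']; rewrite addSnnS IH.
have lev_unbounded n : exists i, (n <= lev (s i))%N.
  elim: n => [|n [i ni]]; first by exists 0.
  by exists ((rem (s i)).+1 + i); rewrite (lev_up _ _ erefl).
have As n : exists i, forall j, (i <= j)%N -> A n (vx (s j)).
  have [i ni] := lev_unbounded n; exists i => j ij.
  apply: (decA' _ _ (leq_trans ni (lev_mono _ _ ij))).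
  by have := svalP (s j); exact: BA.
have [||r [t [tk rt]]] := @walk_ray (vx \o s).
- by move=> i; have [] := nextP (s i).
- move=> x; have [n nAx] := capA x; have [i ia] := As n.
  by exists i => j ij sx; apply: nAx; rewrite -sx; exact: ia.
exists r => n; have [i ia] := As n; exists i => k ik.
by rewrite rt /=; apply: ia; exact: leq_trans ik (tk k).
Qed.

End Walks.

(** * Ends and their components *)

Section EndComponents.
Variable G : graph.
Implicit Types (U C D : set G) (X Y : finsubset G) (w : ends G) (r : ray G).

Lemma component_sub (Z C D : set G) x : component Z C -> connected_in D ->
  D `<=` ~` Z -> C x -> D x -> D `<=` C.
Proof.
move=> cC [_ cD] DZ Cx Dx y Dy; apply: component_closed cC Cx _.
by apply: linked_sub DZ _; exact: cD.
Qed.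

Lemma ends_ray w : exists r, sval w r.
Proof. by case: w => W [r /= ->]; exists r; exact: ray_equiv_refl. Qed.

Definition end_of r : ends G := exist _ [set s | ray_equiv r s] (ex_intro _ r erefl).

Lemma end_component_end_of r X C : component (sval X) C -> contains_tail C r ->
  end_component (sval X) (end_of r) = C.
Proof.
move=> cC tC; apply: (end_component_uniq (svalP X)); split=> // s /= rs.
exact: ray_equiv_tail rs (svalP X) cC tC.
Qed.

Lemma end_component_component X w : component (sval X) (end_component (sval X) w).
Proof. by have [] := end_componentP w (svalP X). Qed.

Lemma end_component_tail X w r : sval w r ->
  contains_tail (end_component (sval X) w) r.
Proof. by have [_] := end_componentP w (svalP X); exact. Qed.

Lemma contains_tail_meet C D r : contains_tail C r -> contains_tail D r ->
  exists x, C x /\ D x.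
Proof.
move=> [n Cn] [m Dm]; exists (r (maxn n m)).
by split; [apply: Cn; exact: leq_maxl|apply: Dm; exact: leq_maxr].
Qed.

Lemma contains_tail_sub C D r : C `<=` D -> contains_tail C r -> contains_tail D r.
Proof. by move=> CD [n Cn]; exists n => m /Cn/CD. Qed.

Lemma end_component_meet X Y w : exists x,
  end_component (sval X) w x /\ end_component (sval Y) w x.
Proof.
have [r wr] := ends_ray w.
by apply: contains_tail_meet; exact: end_component_tail wr.
Qed.

Lemma end_component_direction w :
  direction (fun X => end_component (sval X) w).
Proof.
split=> [X|X Y XY]; first exact: end_component_component.
have [x [Xx Yx]] := end_component_meet X Y w.
have [cY YY _] := end_component_component Y w.
apply: component_sub (end_component_component X w) cY _ Xx Yx.
by move=> y /YY; exact: contra_not (@XY y).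
Qed.

(** Rays with tails in a common component of [G - Z] are not separated by [Z]. *)
Lemma ends_eq w w' :
  (forall X, end_component (sval X) w = end_component (sval X) w') -> w = w'.
Proof.
suff sub v v' : (forall X, end_component (sval X) v = end_component (sval X) v') ->
    sval v `<=` sval v'.
  by move=> ww'; apply: eq_sig_hprop => [?|]; [exact: Prop_irrelevance|rewrite eqEsubset]; split; exact: sub.
case: v' => W' [r' W'E] /= vv' r vr; rewrite W'E /= => Z finZ sep.
pose X : finsubset G := exist _ Z finZ.
have r'W : W' r' by rewrite W'E; exact: ray_equiv_refl.
have tr := end_component_tail X vr.
have [n Cn] := @end_component_tail X (exist _ W' (ex_intro _ r' W'E)) r' r'W.
move: tr; rewrite vv' => -[m Cm].
have Rn : range r' (r' n) by exists n.
have Rm : range r (r m) by exists m.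
apply: (sep _ _ Rn Rm).
have cX := end_component_component X (exist _ W' (ex_intro _ r' W'E)).
have [_ CZ _] := cX; apply: linked_sub CZ _.
by apply: component_connected cX _ _; [exact: Cn|exact: Cm].
Qed.

(** A basic set [Omega Z C] around [w] determines [C] from [Z], so finite vertex sets alone index a
    neighbourhood base. *)
Lemma nbhs_Omega w (A : set (ends G)) : nbhs w A <->
  exists X, Omega (sval X) (end_component (sval X) w) `<=` A.
Proof.
split.
  rewrite nbhsE => -[O [[D DI <-] [[Z C] DZC /= OwC]] OA].
  have [/= finZ cC] := DI _ DZC.
  exists (exist _ Z finZ) => /= v; rewrite OwC => vC; apply: OA.
  by exists (Z, C).
move=> [X XA]; rewrite nbhsE.
exists (Omega (sval X) (end_component (sval X) w)) => //; split=> //.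
exists [set (sval X, end_component (sval X) w)].
  by move=> _ ->; split=> /=; [exact: (svalP X)|exact: end_component_component].
by rewrite bigcup_set1.
Qed.

End EndComponents.

(** * Walk-closed sets, and directions as ends *)

Section ClosedSets.
Variable G : graph.
Implicit Types (U C D : set G) (X Y : finsubset G) (w : ends G) (r : ray G).

Definition walk_closed U := forall X u v, sval X `<=` U -> U u -> U v ->
  linked (~` sval X) u v -> linked (U `\` sval X) u v.

(** Close [A] under [F] and under one finite linking set [P t] for each finite set and pair of
    vertices. *)
Lemma walk_closed_hull (F : finsubset G -> set G) A : countable A ->
  (forall X, countable (F X)) ->
  exists U, [/\ countable U, A `<=` U, walk_closed U &
                forall X, sval X `<=` U -> F X `<=` U].
Proof.
move=> cA cF.
have /choice[P PP] : forall t : set G * (G * G), exists Z, finite_set Z /\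
    (linked (~` t.1) t.2.1 t.2.2 -> Z `<=` ~` t.1 /\ linked Z t.2.1 t.2.2).
  move=> t; have [/linked_finite[Z [? ? ?]]|h] :=
    pselect (linked (~` t.1) t.2.1 t.2.2); first by exists Z.
  by exists set0.
(* [F] takes a set bundled with a finiteness proof; by proof irrelevance this union has a single
   term when [Y] is finite. *)
pose E (Y : set G) : set G := \bigcup_(X in [set X | sval X = Y]) F X.
pose W (Y : set G) : set G :=
  \bigcup_(t in [set Z | Z `<=` Y /\ finite_set Z] `*` (Y `*` Y)) P t.
have [||U [cU AU UF]] := @countable_closure G (fun Z => E Z `|` W Z) A => //.
- move=> Y finY; apply: countable_setU.
    have -> : E Y = F (exist _ Y finY).
      rewrite eqEsubset; split=> x; last by exists (exist _ Y finY).
      by case=> -[Z finZ] /= ZY; subst Z; rewrite (Prop_irrelevance finZ finY).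
    exact: cF.
  have cY := finite_set_countable finY.
  apply: bigcup_countable => [|t _].
    by apply: countableX; [exact: countable_finite_subset|exact: countableX].
  by apply: finite_set_countable; have [] := PP t.
exists U; split=> //.
- move=> [X finX] /= u v XU Uu Uv uv.
  have [finP /(_ uv)/=[PX Puv]] := PP (X, (u, v)).
  apply: linked_sub Puv => x Px; split; last exact: PX.
  pose Y := X `|` ([set u] `|` [set v]).
  apply: (UF Y); first by rewrite /Y !finite_setU; split.
    by move=> y [/XU//|[->|->]].
  right; exists (X, (u, v)) => //; split=> /=; last first.
    by split=> /=; right; [left|right].
  by split=> // y Xy; left.
- move=> [X finX] /= XU x Fx; apply: (UF X) => //.
  by left; exists (exist _ X finX).
Qed.

(** A walk in [U] that avoids [X] and starts in [C] never leaves [C]. *)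
Lemma walk_closed_connected U X C : walk_closed U -> sval X `<=` U ->
  component (sval X) C -> (C `&` U) !=set0 -> connected_in (C `&` U).
Proof.
move=> clU XU cC CU0; split=> // u v [Cu Uu] [Cv Uv].
have uv : linked (~` sval X) u v.
  by have [_ CX _] := cC; exact: linked_sub CX (component_connected cC Cu Cv).
apply: linked_sub (linked_class (clU X u v XU Uu Uv uv)) => y uy; split.
  by apply: component_closed cC Cu _; apply: linked_sub uy => z [].
by have [] := linked_right uy.
Qed.

(** Along an exhaustion of [U], the traces of [f] on [U] are connected and decreasing, and every
    vertex of [U] eventually drops out, so [decreasing_ray] applies. *)
Lemma direction_ray f U : direction f -> countable U -> walk_closed U ->
  (forall X, sval X `<=` U -> (f X `&` U) !=set0) ->
  exists r, forall X, sval X `<=` U -> contains_tail (f X `&` U) r.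
Proof.
move=> [fC fS] cU clU fU0; have [Y [finY YU YS Yfin]] := countable_exhaustion cU.
pose Z n : finsubset G := exist _ (Y n) (finY n).
have [||x|r rP] := @decreasing_ray G (fun n => f (Z n) `&` U).
- by move=> n; apply: (walk_closed_connected clU _ (fC (Z n)));
    [exact: YU|apply: fU0; exact: YU].
- by move=> n x [fx Ux]; split=> //; move: fx; apply: fS; exact: YS.
- have [Ux|nUx] := pselect (U x); last by exists 0 => -[].
  have [|n xY] := Yfin _ (finite_set1 x); first by move=> y ->.
  by exists n => -[/(component_avoids (fC (Z n)))]; case; exact: xY.
exists r => X XU; have [n XY] := Yfin _ (svalP X) XU.
by apply: contains_tail_sub (rP n) => x [fx Ux]; split=> //; move: fx; exact: fS.
Qed.

(* Diestel and Kuehn. A vertex [v] dominates [f] if it lies in [f X] for all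
   finite [X] not containing [v]. The set [U] contains, with every [v] that does
   not dominate [f], some [Xw v] witnessing this, and a ray of [U] follows [f] on
   the finite subsets of [U]. If a finite [X] separated the ray from [f], then [f]
   would point into a component of [G - U], each of whose neighbours must
   dominate [f]; but some such neighbour is on the side of the ray. *)
Lemma direction_end f : direction f ->
  exists w, f = (fun X => end_component (sval X) w).
Proof.
move=> df; have [fC fS] := df.
pose dom v := forall X, ~ sval X v -> f X v.
have /choice[Xw XwP] : forall v, exists X, dom v \/ ~ sval X v /\ ~ f X v.
  move=> v; have [dv|] := pselect (dom v).
    by exists (exist _ set0 (finite_set0 _)); left.
  by move=> /existsNP[X /not_implyP h]; exists X; right.
have /choice[p fp] X : exists x, f X x by exact: component_neq0 (fC X).
pose F X := [set p X] `|` \bigcup_(v in sval X) sval (Xw v).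
have [||U [cU _ clU UF]] := @walk_closed_hull F set0 => //.
  move=> X; apply: countable_setU; first exact: countable1.
  apply: bigcup_countable => [|v _]; first exact: finite_set_countable (svalP X).
  exact: finite_set_countable (svalP (Xw v)).
have fU0 X : sval X `<=` U -> (f X `&` U) !=set0.
  by move=> XU; exists (p X); split; [exact: fp|apply: (UF X XU); left].
have UXw v : U v -> sval (Xw v) `<=` U.
  move=> Uv x Xx; apply: (UF (exist _ _ (finite_set1 v))) => [y ->//|].
  by right; exists v.
have [r rP] := direction_ray df cU clU fU0.
exists (end_of r); apply/funext => X; apply/esym.
apply: end_component_end_of (fC X) _.
pose Y : finsubset G :=
  exist _ (sval X `&` U) (sub_finite_set (@subIsetl _ _ _) (svalP X)).
have YU : sval Y `<=` U by move=> x [].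
pose fsU X X' : finsubset G := exist _ (sval X `|` sval X')
  (eq_ind_r id (conj (svalP X) (svalP X')) (finite_setU _ _)).
(* The trace of [f Y] on [U] is connected and avoids [X], so one vertex shared with [f X] puts it
   inside [f X]. *)
suff [a [[fYa Ua] fXa]] : exists a, (f Y `&` U) a /\ f X a.
  apply: contains_tail_sub (rP Y YU).
  have cA := walk_closed_connected clU YU (fC Y) (fU0 Y YU).
  apply: (component_sub (fC X) cA _ fXa) => // x [fx Ux] Xx.
  by apply: (component_avoids (fC Y) fx); split.
apply: contrapT => nE.
have fsUl X1 X2 : f (fsU X1 X2) `<=` f X1 by apply: fS => x; left.
have fsUr X1 X2 : f (fsU X1 X2) `<=` f X2 by apply: fS => x; right.
pose D := f (fsU X Y).
have nUD X' : f (fsU X (fsU Y X')) `<=` ~` U.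
  move=> x fx Ux; apply: nE; exists x; split; last exact: fsUl fx.
  by split=> //; apply: (fsUl Y X'); exact: fsUr fx.
have nUD' : D `<=` ~` U.
  move=> x fx Ux; apply: nE; exists x; split; last exact: fsUl fx.
  by split=> //; exact: fsUr fx.
(* [D] avoids [U], hence [X'], so it stays in the component chosen by [f] when [X'] is deleted
   too. *)
have DX' X' : sval X' `<=` U -> D `<=` f X'.
  move=> X'U.
  have [y fy] := component_neq0 (fC (fsU X (fsU Y X'))).
  have Dy : D y by move: fy; apply: fS => x [Xx|Yx]; [left|right; left].
  have DI : D `<=` f (fsU X (fsU Y X')).
    have [cD _ _] := fC (fsU X Y).
    apply: (component_sub (fC _) cD _ fy Dy) => x Dx [Xx|[[Xx _]|/X'U//]].
    - by apply: (component_avoids (fC _) Dx); left.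
    - by apply: (component_avoids (fC _) Dx); left.
    - exact: nUD'.
  by move=> x /DI h; apply: (fsUr Y); exact: fsUr h.
have [d Dd] := component_neq0 (fC (fsU X Y)).
have dU : ~ U d by exact: nUD'.
have K_sub X' : sval X' `<=` U -> linked (~` U) d `<=` f X'.
  move=> X'U y dy; apply: component_closed (fC X') (DX' _ X'U _ Dd) _.
  by apply: linked_sub dy; exact: subsetC.
have [a [fYa Ua]] := fU0 Y YU.
have da := component_connected (fC Y) (DX' Y YU _ Dd) fYa.
(* A walk from [d] to [a] inside [f Y] must enter [U], at a neighbour [v] of the component of
   [G - U] containing [d]. *)
have [b [v [db bv fYv nv]]] : exists b v, [/\ linked (f Y `&` (~` U)) d b, adj b v,
    f Y v & ~ (~` U) v] by apply: linked_exit da dU _.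
have Uv : U v by exact: contrapT.
have [dv|[nXv nfv]] := XwP v.
  apply: nE; exists v; split=> //; apply: dv => Xv.
  by apply: (component_avoids (fC Y) fYv).
apply: nfv.
have fb : f (Xw v) b.
  by apply: K_sub; [exact: UXw|apply: linked_sub db => x []].
apply: (component_closed (fC (Xw v)) fb); apply: linked_adj => //.
exact: component_avoids (fC (Xw v)) fb.
Qed.

End ClosedSets.

(** * From a countable base to countably many choices *)

Section SecondCountable.
Variable G : graph.
Implicit Types (U C D : set G) (X Y : finsubset G) (w : ends G).

Lemma second_countable_determined :
  @second_countable (ends G) -> countably_determined G.
Proof.
move=> [B cB [Bopen Bnbhs]].
(* Where no choice fits between the two sets, [g] is arbitrary; values that are not directional
   choices are discarded below. *)
have /choice[g gP] : forall p : set (ends G) * set (ends G),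
    exists XC : finsubset G * set G,
      (exists XC, directional_choice XC /\
        [/\ p.1 `<=` Omega (sval XC.1) XC.2 & Omega (sval XC.1) XC.2 `<=` p.2]) ->
      directional_choice XC /\ [/\ p.1 `<=` Omega (sval XC.1) XC.2 & Omega (sval XC.1) XC.2 `<=` p.2].
  move=> p; have [[XC h]|nh] := pselect (exists XC : finsubset G * set G,
      directional_choice XC /\ [/\ p.1 `<=` Omega (sval XC.1) XC.2 & Omega (sval XC.1) XC.2 `<=` p.2]).
    by exists XC.
  by exists (exist _ set0 (finite_set0 _), set0).
exists (g @` (B `*` B) `&` @directional_choice G); split.
- apply: (@sub_countable _ _ _ (g @` (B `*` B))).
    by apply: subset_card_le; exact: subIsetl.
  by apply: sub_countable (card_image_le _ _) _; exact: countableX.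
- exact: subIsetr.
move=> f h /direction_end[w ->] /direction_end[v ->] wv.
have [X Xwv] : exists X, end_component (sval X) v <> end_component (sval X) w.
  by apply/existsNP => vw; apply: wv; rewrite (ends_eq vw).
(* The aim is a chain from [b'] through [Omega] of [Y] and [b] up to [Omega] of [X], with [w] in
   [b'] and [v] outside the last set. Then [g (b', b)] holds for [w] and fails for [v]. *)
have base Y : exists2 b, B b & b w /\ b `<=` Omega (sval Y) (end_component (sval Y) w).
  have [|b [Bb bw] bY] := Bnbhs w (Omega (sval Y) (end_component (sval Y) w)).
    by apply/nbhs_Omega; exists Y.
  by exists b.
have [b Bb [bw bX]] := base X.
have [Y Yb] : exists Y, Omega (sval Y) (end_component (sval Y) w) `<=` b.
  by apply/nbhs_Omega; apply: open_nbhs_nbhs; split=> //; exact: Bopen.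
have [b' Bb' [b'w b'Y]] := base Y.
have [|gd [gb' gb]] := gP (b', b).
  exists (Y, end_component (sval Y) w); split=> //.
  exact: end_component_component.
exists (g (b', b)); first by split=> //; exists (b', b).
split; first exact: gb'.
by move=> gv; apply: Xwv; apply: bX; exact: gb.
Qed.

(** * From countably many choices to a countable base *)

Section Determined.
Variable S : set (finsubset G * set G).
Hypothesis cS : countable S.
Hypothesis S_dist : forall f h, direction f -> direction h -> f <> h ->
  exists2 XC : finsubset G * set G, S XC & distinguishes XC f h.

Let U0 : set G := \bigcup_(XC in S) sval XC.1.

Lemma countable_U0 : countable U0.
Proof.
apply: bigcup_countable => // XC _.
exact: finite_set_countable (svalP XC.1).
Qed.

Lemma S_dist_ends w v : w <> v -> exists2 XC : finsubset G * set G, S XC &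
  end_component (sval XC.1) w = XC.2 /\ end_component (sval XC.1) v <> XC.2.
Proof.
move=> wv.
apply: (S_dist (end_component_direction w) (end_component_direction v)).
by move=> fwv; apply: wv; apply: ends_eq => X; have := congr1 (fun f => f X) fwv.
Qed.

(* All but countably many components of [G - X] that contain an end avoid [U0]
   and do not occur in [S]; such a component is determined by its neighbourhood
   in [X], since two with the same neighbourhood cannot be told apart by [S]. *)
Lemma countable_end_components X :
  countable [set end_component (sval X) w | w in [set: ends G]].
Proof.
set E := image _ _.
pose R := E `&` [set C | C `&` U0 = set0 /\ ~ (snd @` S) C].
pose N C := [set x | sval X x /\ exists2 y, C y & adj y x].
suff cR : countable R.
  apply: (@sub_countable _ _ _ ((fun x => linked (~` sval X) x) @` U0 `|`
    (snd @` S `|` R))).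
    apply: subset_card_le => C EC.
    have [[x [Cx Ux]]|CU] := pselect (exists x, (C `&` U0) x).
      left; exists x => //; case: EC => w _ wC.
      have cC : component (sval X) C by rewrite -wC; exact: end_component_component.
      by rewrite (component_linked cC Cx).
    have [SC|nSC] := pselect ((snd @` S) C); first by right; left.
    right; right; split=> //; split=> //.
    by rewrite -subset0 => x Cx; apply: CU; exists x.
  apply: countable_setU.
    by apply: sub_countable (card_image_le _ _) _; exact: countable_U0.
  by apply: countable_setU => //; exact: sub_countable (card_image_le _ _) _.
have Ninj : {in R &, injective N}.
  move=> C C'; rewrite !inE => -[[w _ wC] [CU nSC]] [[v _ vC'] [C'U _]] NN.
  apply: contrapT => CC'; have wv : w <> v by move=> wv; apply: CC'; rewrite -wC wv.
  have [[Y D] SYD /= [wD vD]] := S_dist_ends wv.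
  have YU : sval Y `<=` U0 by move=> x Yx; exists (Y, D).
  have avoid K : K `&` U0 = set0 -> K `<=` ~` sval Y.
    by move=> KU x Kx /YU Ux; have : (K `&` U0) x by []; rewrite KU.
  have cC : component (sval X) C by rewrite -wC; exact: end_component_component.
  have cC' : component (sval X) C' by rewrite -vC'; exact: end_component_component.
  have cD : component (sval Y) D by rewrite -wD; exact: end_component_component.
  have cD' := end_component_component Y v.
  set D' := end_component (sval Y) v in cD' vD.
  have [c [Cc Dc]] : exists x, C x /\ D x.
    by have := end_component_meet X Y w; rewrite wC wD.
  have [c' [C'c' D'c']] : exists x, C' x /\ D' x.
    by have := end_component_meet X Y v; rewrite vC'.
  have CD : C `<=` D by have [h _ _] := cC; exact: component_sub cD h (avoid _ CU) Dc Cc.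
  have CD' : C' `<=` D'.
    by have [h _ _] := cC'; exact: component_sub cD' h (avoid _ C'U) D'c' C'c'.
  (* A common neighbour of [C] and [C'] outside [Y] would merge [D] with [D']. *)
  have NCY : N C `<=` sval Y.
    move=> x NCx; apply: contrapT => nYx; apply: vD.
    have [_ [y Cy yx]] := NCx.
    have [_ [y' C'y' y'x]] : N C' x by rewrite -NN.
    apply: (component_uniq (x := x) cD' cD).
      apply: (component_closed cD' (CD' _ C'y')); apply: linked_adj => //.
      exact: avoid C'y'.
    apply: (component_closed cD (CD _ Cy)); apply: linked_adj => //.
    exact: avoid Cy.
  (* A walk in [D] that leaves [C] meets [N C], hence [Y], which [D] avoids. So [C = D] occurs in
     [S]. *)
  apply: nSC; exists (Y, D) => //=; rewrite eqEsubset; split=> // d Dd.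
  apply: contrapT => nCd.
  have [a [b [ca ab Db nCb]]] := linked_exit (component_connected cD Dc Dd) Cc nCd.
  have [_ Ca] := linked_right ca.
  apply: (component_avoids cD Db); apply: NCY; split; last by exists a.
  apply: contrapT => nXb; apply: nCb.
  apply: (component_closed cC Ca); apply: linked_adj => //.
  exact: component_avoids cC Ca.
have : countable (N @` R).
  apply: (@sub_countable _ _ _ [set Z | Z `<=` sval X /\ finite_set Z]); last first.
    by apply: countable_finite_subset; exact: finite_set_countable (svalP X).
  apply: subset_card_le => _ [C _ <-].
  have NX : N C `<=` sval X by move=> x [].
  by split=> //; exact: sub_finite_set (svalP X).
move=> /countable_injP[k kinj]; apply/countable_injP; exists (k \o N).
move=> C C' RC RC' /= kNN; apply: Ninj => //; apply: kinj => //; rewrite inE.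
  by exists C => //; rewrite inE in RC.
by exists C' => //; rewrite inE in RC'.
Qed.

(** A choice in [S] between [w] and the end of the ray from [direction_ray] would have its vertex
    set inside [U], where that ray follows [w]. *)
Lemma end_ray_in U w : U0 `<=` U -> countable U -> walk_closed U ->
  (forall X, sval X `<=` U -> (end_component (sval X) w `&` U) !=set0) ->
  exists2 r, sval w r &
    forall X, sval X `<=` U -> contains_tail (end_component (sval X) w `&` U) r.
Proof.
move=> U0U cU clU wU.
have [r rP] := direction_ray (end_component_direction w) cU clU wU.
exists r => //; suff <- : end_of r = w by exact: ray_equiv_refl.
apply: contrapT => /S_dist_ends[[Y D] SYD /= [<-]]; apply; apply/esym.
apply: end_component_end_of; first exact: end_component_component.
apply: contains_tail_sub (rP Y _) => [x []//|x Yx].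
by apply: U0U; exists (Y, D).
Qed.

Lemma determined_second_countable : @second_countable (ends G).
Proof.
have /choice[p pP] : forall C : set G, exists P : set G,
    countable P /\ (C !=set0 -> (C `&` P) !=set0).
  move=> C; have [[x Cx]|nC] := pselect (C !=set0); last by exists set0.
  by exists [set x]; split; [exact: countable1|exists x].
pose E Z := [set end_component Z w | w in [set: ends G]].
(* [F X] meets every component of [G - X] that contains an end, and is countable since there are
   only countably many of these. *)
pose F X := \bigcup_(C in E (sval X)) p C.
have [|X|U [cU U0U clU UF]] := @walk_closed_hull G F U0.
- exact: countable_U0.
- apply: bigcup_countable => [|C _]; first exact: countable_end_components.
  by have [] := pP C.
have wU w X : sval X `<=` U -> (end_component (sval X) w `&` U) !=set0.
  move=> XU; have [_ [|x [wx px]]] := pP (end_component (sval X) w).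
    exact: component_neq0 (end_component_component X w).
  exists x; split=> //; apply: (UF X XU).
  by exists (end_component (sval X) w) => //; exists w.
exists (\bigcup_(Z in [set Z | Z `<=` U /\ finite_set Z]) Omega Z @` E Z).
  apply: bigcup_countable => [|Z [_ finZ]]; first exact: countable_finite_subset.
  apply: sub_countable (card_image_le _ _) _.
  exact: (countable_end_components (exist _ Z finZ)).
split.
  move=> _ [Z [_ finZ] [_ [w _ <-] <-]].
  rewrite openE => v vZ; apply/nbhs_Omega.
  by exists (exist _ Z finZ); rewrite /= vZ.
move=> w A /nbhs_Omega[X XA].
pose Y : finsubset G :=
  exist _ (sval X `&` U) (sub_finite_set (@subIsetl _ _ _) (svalP X)).
have YU : sval Y `<=` U by move=> x [].
exists (Omega (sval Y) (end_component (sval Y) w)).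
  split=> //; exists (sval Y); first by split=> //; exact: (svalP Y).
  by exists (end_component (sval Y) w) => //; exists w.
set C := end_component (sval Y) w.
have cC : component (sval Y) C by exact: end_component_component.
have cCU : connected_in (C `&` U) by apply: walk_closed_connected cC _ => //; exact: wU.
have CUX : C `&` U `<=` ~` sval X.
  by move=> x [Cx Ux] Xx; apply: (component_avoids cC Cx); split.
(* Some ray of [v] has a tail in the trace of [C] on [U]. This trace is connected and avoids [X], so
   all of it lies in the component of [v]; applied to [w] as well, this makes the two components
   meet. *)
have CU_sub v : end_component (sval Y) v = C -> C `&` U `<=` end_component (sval X) v.
  move=> vC; have [r vr rP] := @end_ray_in U v U0U cU clU (wU v).
  have := rP Y YU; rewrite vC => tC.
  have [x [xv xC]] := contains_tail_meet (end_component_tail X vr) tC.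
  exact: component_sub (end_component_component X v) cCU CUX xv xC.
move=> v vC; apply: XA; have [[x CUx] _] := cCU.
apply: (component_uniq (x := x)).
- exact: end_component_component.
- exact: end_component_component.
- exact: CU_sub CUx.
- exact: CU_sub CUx.
Qed.

End Determined.
End SecondCountable.

Theorem theorem4p7 : forall G : graph,
  @second_countable (ends G) <-> countably_determined G.
Proof.
move=> G; split; first exact: second_countable_determined.
by move=> [S [cS _ Sdist]]; exact: determined_second_countable cS Sdist.
Qed.
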